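(* Let $\mathcal{A}$ be a finite or countable alphabet and $\mathcal{M}$ a set of $K<\infty$ probability measures on $\mathcal{A}^\infty$, let $w$ be the uniform prior $w_\nu=1/K$, $\xi$ the Bayes mixture and $\mu\in\mathcal{M}$. Then $\mathbb{E}_\mu C_\infty\le 6\ln^2 K+14\ln K+8$.
   Context: $\mathcal{A}^\infty$ carries the $\sigma$-algebra generated by cylinders $\Gamma_x=\{x\omega\}$; for a measure $\rho$, $\rho(x):=\rho(\Gamma_x)$, $\rho(y|x):=\rho(xy)/\rho(x)$. Bayes mixture: $\xi(A):=\sum_{\nu\in\mathcal{M}}w_\nu\nu(A)$; posterior $w_\nu(x):=w_\nu\nu(x)/\xi(x)$. Logarithms are natural. For a finite string $x$ and $\nu\in\mathcal{M}$, $d_x(\nu,\xi):=\sum_{a\in\mathcal{A}}\nu(a|x)\ln\frac{\nu(a|x)}{\xi(a|x)}$. For $\omega\in\mathcal{A}^\infty$, $c_t(\omega):=\sum_{\nu\in\mathcal{M}}w_\nu(\omega_{<t})\,d_{\omega_{<t}}(\nu,\xi)$ with $\omega_{<t}=\omega_1\cdots\omega_{t-1}$, and $C_\infty:=\sum_{t=1}^\infty c_t$. *)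

(* Defs.v *)
From HB Require Import structures.
From mathcomp Require Import all_boot all_order all_algebra.
From mathcomp Require Import all_classical all_reals all_analysis.
Set Implicit Arguments. Unset Strict Implicit. Unset Printing Implicit Defensive.
Import Order.TTheory GRing.Theory Num.Theory.
Local Open Scope classical_set_scope.
Local Open Scope ring_scope.

(* Infinite sequences over the alphabet A are functions nat -> A.
   omega_{<t} (the first t-1 symbols) is [prefix om t.-1]. *)
Definition prefix {A : Type} (om : nat -> A) (n : nat) : seq A := mkseq om n.

Definition cyl {A : Type} (x : seq A) : set (nat -> A) :=
  [set om | prefix om (size x) = x].

Definition cylinders (A : Type) : set (set (nat -> A)) := range (@cyl A).

Definition seqspace (A : pointedType) := g_sigma_algebraType (@cylinders A).

Section Bayes.
Variables (R : realType) (A : pointedType).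

Definition cylm (rho : set (seqspace A) -> \bar R) (x : seq A) : R :=
  fine (rho (cyl x)).

Definition condm (rho : seq A -> R) (x : seq A) (a : A) : R :=
  rho (rcons x a) / rho x.

Variables (K : nat) (nu : 'I_K -> probability (seqspace A) R).

Definition wprior : R := K%:R^-1.

Definition xi (x : seq A) : R := \sum_(i < K) wprior * cylm (nu i) x.

Definition wpost (i : 'I_K) (x : seq A) : R := wprior * cylm (nu i) x / xi x.

Definition dterm (i : 'I_K) (x : seq A) (a : A) : R :=
  condm (cylm (nu i)) x a * ln (condm (cylm (nu i)) x a / condm xi x a).

(* d_x(nu, xi) = sum_{a in A} nu(a|x) ln (nu(a|x)/xi(a|x)), the sum over the
   (countable) alphabet taken as (sum of positive parts) - (sum of negative
   parts) *)
Definition dKL (i : 'I_K) (x : seq A) : \bar R :=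
  (\esum_(a in [set: A]) (fun b => (dterm i x b)%:E)^\+ a -
   \esum_(a in [set: A]) (fun b => (dterm i x b)%:E)^\- a)%E.

Definition ct (t : nat) (om : nat -> A) : \bar R :=
  (\sum_(i < K) (wpost i (prefix om t.-1))%:E * dKL i (prefix om t.-1))%E.

Definition Cinf (om : nat -> A) : \bar R :=
  (\sum_(1 <= t <oo) ct t om)%E.

End Bayes.

(* Main.v *)
Require Import Defs.
From HB Require Import structures.
From mathcomp Require Import all_boot all_order all_algebra.
From mathcomp Require Import all_classical all_reals all_analysis.
From mathcomp Require Import measurable_realfun ring lra.
Import Order.TTheory GRing.Theory Num.Theory.
Local Open Scope classical_set_scope.
Local Open Scope ring_scope.

(** Let [p] be the posterior of [mu], [M] its running maximum along a string
and [H] the posterior entropy, so that [0 <= H <= ln K].  As [mu = K p xi], the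
[mu]-expectation of [C] is [K] times the [xi]-expectation of [sum_t p_t c_t],
which is at most that of [sum_t M_t c_t].  Under [xi], [p] is a martingale and
[c_t] is the expected decrease of [H], hence the potential
<<
  Phi = M H + ln K * p * ln (1 / M)
>>
decreases in expectation by at least [M_t c_t] at each step: when the maximum
grows from [M] to [M' = p'], the first summand gains at most [(M' - M) ln K]
and the second one loses [ln K * M' ln (M' / M)], which is at least as much.
Initially [Phi = (ln K + ln^2 K) / K], so the expectation of [C] is at most
[ln^2 K + ln K]. *)

Set Implicit Arguments.
Unset Strict Implicit.
Unset Printing Implicit Defensive.

(** * Countable unions and integrals over countable partitions *)

Lemma countable_seq (T : Type) :
  countable [set: T] -> countable [set: seq T].
Proof.
move=> /countable_injP[f /in2TT finj]; apply/countable_injP.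
exists (fun s => choice.pickle (map f s)) => s t _ _.
by move=> /(pcan_inj choice.pickleK)/(inj_map finj).
Qed.

Lemma countable_bigcup_measurable (d : measure_display) (T : measurableType d)
  (I : Type) (S : set I) (F : I -> set T) : countable S ->
  (forall i, S i -> measurable (F i)) -> measurable (\bigcup_(i in S) F i).
Proof.
move=> /countable_injP[e einj] mF.
(* Grouping the indices by their code [e] gives a union over [nat]; by injectivity each group is a
   single [F i] or empty. *)
have -> : \bigcup_(i in S) F i =
    \bigcup_k \bigcup_(i in [set i | S i /\ e i = k]) F i.
  apply/seteqP; split=> [x [i Si Fix]|x [k _ [i [Si _] Fix]]]; last by exists i.
  by exists (e i) => //; exists i.
apply: bigcupT_measurable => k.
have [[i Si eik]|H] := pselect (exists2 i, S i & e i = k).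
  rewrite (_ : \bigcup_(_ in _) _ = F i); first exact: mF.
  apply/seteqP; split=> [x [j [Sj ejk]]|x Fix]; last by exists i.
  by rewrite (einj j i) ?inE// ejk eik.
rewrite (_ : \bigcup_(_ in _) _ = set0)//.
by apply/seteqP; split=> // x [j [Sj ejk] _]; case: H; exists j.
Qed.

Section countable_partition.
Context (d : measure_display) (T : measurableType d) (R : realType).
Variable mu : {measure set T -> \bar R}.
Context (I : choiceType) (S : set I) (F : I -> set T).
Hypotheses (cS : countable S) (mF : forall i, S i -> measurable (F i)).
Hypothesis tF : trivIset S F.

Lemma ge0_integral_countable_bigcup (f : T -> \bar R) :
  measurable_fun (\bigcup_(i in S) F i) f -> (forall x, 0 <= f x)%E ->
  (\int[mu]_(x in \bigcup_(i in S) F i) f x =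
   \esum_(i in S) \int[mu]_(x in F i) f x)%E.
Proof.
move=> mf f0; have /countable_injP[e einj] := cS.
pose G k := \bigcup_(i in [set i | S i /\ e i = k]) F i.
have GE i : S i -> G (e i) = F i.
  move=> Si; apply/seteqP; split=> [x [j [Sj eji]]|x Fix]; last by exists i.
  by rewrite (einj j i) ?inE.
have G0 k : ~ (e @` S) k -> G k = set0.
  by move=> H; apply/seteqP; split=> // x [j [Sj ejk] _]; case: H; exists j.
have UG : \bigcup_(i in S) F i = \bigcup_k G k.
  apply/seteqP; split=> [x [i Si Fix]|x [k _ [i [Si _] Fix]]]; last by exists i.
  by exists (e i) => //; rewrite GE.
have mG k : measurable (G k).
  by apply: countable_bigcup_measurable => [|i [Si _]]; [exact: sub_countable
    (subset_card_le (fun i => @proj1 _ _)) cS|exact: mF].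
rewrite UG ge0_integral_bigcup//; last 2 first.
- by rewrite -UG.
- move=> k l _ _ [x [[i [Si <-] Fix] [j [Sj <-] Fjx]]].
  by congr e; apply: tF => //; exists x.
rewrite nneseries_esumT; last by move=> k; exact: integral_ge0.
(* Numbers that code no index of [S] only contribute integrals over the empty set. *)
rewrite (esumID (e @` S)); last by move=> k _; exact: integral_ge0.
rewrite [X in (_ + X)%E]esum1 ?adde0; last first.
  by move=> k [_ /= /G0 ->]; rewrite integral_set0.
rewrite setTI esum_image; first by apply: eq_esum => i Si; rewrite GE.
by move=> i j /[!inE] Si Sj; apply: einj; rewrite inE.
Qed.

Lemma measure_countable_bigcup :
  (mu (\bigcup_(i in S) F i) = \esum_(i in S) mu (F i))%E.
Proof.
have mU : measurable (\bigcup_(i in S) F i).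
  exact: countable_bigcup_measurable.
rewrite -[LHS]mul1e -integral_cst// ge0_integral_countable_bigcup//.
by apply: eq_esum => i Si; rewrite integral_cst ?mul1e//; exact: mF.
Qed.

End countable_partition.

(** * Cylinders and functions of a finite prefix *)

Section cylinders.
Context (R : realType) (A : pointedType).
Hypothesis hA : countable [set: A].
Local Notation prefix := Defs.prefix.
Local Notation strings n := [set x : seq A | size x = n].

Lemma cylE (x : seq A) (om : nat -> A) : cyl x om = (prefix om (size x) = x).
Proof. by []. Qed.

Lemma size_prefix (om : nat -> A) n : size (prefix om n) = n.
Proof. exact: size_mkseq. Qed.

Lemma cyl_nil : cyl ([::] : seq A) = setT.
Proof. by apply/seteqP; split. Qed.

Lemma measurable_cyl (x : seq A) : measurable (cyl x : set (seqspace A)).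
Proof. by apply: sub_sigma_algebra; exists x. Qed.

Lemma countable_strings n : countable (strings n).
Proof.
exact: sub_countable (subset_card_le (@subsetT _ _)) (countable_seq hA).
Qed.

Lemma trivIset_cyl n : trivIset (strings n) (@cyl A).
Proof.
by move=> x y /= xn yn [om []]; rewrite !cylE xn yn => <- <-.
Qed.

Lemma bigcup_cyl n (S : set (seq A)) :
  \bigcup_(x in strings n `&` S) cyl x = [set om | S (prefix om n)].
Proof.
apply/seteqP; split=> om /=; first by move=> [x [<- Sx]] xom; rewrite xom.
by move=> Som; exists (prefix om n); rewrite ?cylE/= size_prefix.
Qed.

Lemma cyl_rcons (x : seq A) : cyl x = \bigcup_a cyl (rcons x a).
Proof.
apply/seteqP; split=> om.
  move=> xom; exists (om (size x)) => //; rewrite cylE size_rcons /Defs.prefix.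
  by rewrite mkseqS -/(prefix om (size x)) xom.
move=> [a _]; rewrite !cylE size_rcons /Defs.prefix mkseqS.
by move=> /rcons_inj[].
Qed.

Lemma trivIset_cyl_rcons (x : seq A) :
  trivIset setT (fun a => cyl (rcons x a)).
Proof.
move=> a b _ _ [om []]; rewrite !cylE !size_rcons => -> /rcons_inj[].
by [].
Qed.

(** A preimage consists of the sequences whose length-[n] prefix lies in some set of strings, so it
    is a countable union of cylinders. *)
Lemma measurable_prefix n (f : seq A -> \bar R) :
  measurable_fun setT (fun om : seqspace A => f (prefix om n)).
Proof.
move=> _ Y mY; rewrite setTI.
rewrite (_ : _ @^-1` _ = [set om | (f @^-1` Y) (prefix om n)])//.
rewrite -bigcup_cyl; apply: countable_bigcup_measurable => [|x _].
  exact: sub_countable (subset_card_le (@subIsetl _ _ _)) (countable_strings n).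
exact: measurable_cyl.
Qed.

Variable P : probability (seqspace A) R.

Lemma cylmE x : (cylm P x)%:E = P (cyl x).
Proof. by rewrite fineK// fin_num_measure//; exact: measurable_cyl. Qed.

Lemma cylm_ge0 x : 0 <= cylm P x.
Proof. exact: fine_ge0. Qed.

Lemma cylm_nil : cylm P [::] = 1.
Proof. by rewrite /cylm cyl_nil probability_setT. Qed.

(** Consistency of cylinder masses: the cylinders of the one-symbol extensions of [x] partition that
    of [x]. *)
Lemma esum_cylm_rcons x :
  (\esum_(a in [set: A]) (cylm P (rcons x a))%:E = (cylm P x)%:E)%E.
Proof.
rewrite cylmE cyl_rcons measure_countable_bigcup//.
- by apply: eq_esum => a _; rewrite cylmE.
- by move=> a _; exact: measurable_cyl.
- exact: trivIset_cyl_rcons.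
Qed.

(** The integrand is constant on each cylinder of length [n], and these countably many cylinders
    partition the space. *)
Lemma integral_prefix n (f : seq A -> \bar R) : (forall x, 0 <= f x)%E ->
  (\int[P]_om f (prefix om n) = \esum_(x in strings n) (f x * (cylm P x)%:E))%E.
Proof.
move=> f0; have UT : \bigcup_(x in strings n) cyl x = [set: seqspace A].
  by have := bigcup_cyl n setT; rewrite setIT => ->; apply/seteqP; split.
rewrite -UT ge0_integral_countable_bigcup//; last 4 first.
- exact: countable_strings.
- by move=> x _; exact: measurable_cyl.
- exact: trivIset_cyl.
- by rewrite UT; exact: measurable_prefix.
apply: eq_esum => x xn; rewrite cylmE -integral_cst; last exact: measurable_cyl.
apply: eq_integral => om; rewrite inE => omx.
by move: omx; rewrite cylE xn => ->.
Qed.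

Lemma esum_strings_rcons n (f : seq A -> \bar R) : (forall x, 0 <= f x)%E ->
  (\esum_(x in strings n.+1) f x =
   \esum_(x in strings n) \esum_(a in [set: A]) f (rcons x a))%E.
Proof.
move=> f0; rewrite esum_esum//; apply: reindex_esum; split.
- by move=> [x a] /= [/= xn _]; rewrite size_rcons xn.
- by move=> [x a] [y b] _ _ /= /rcons_inj[-> ->].
- move=> y /=; case/lastP: y => // x a; rewrite size_rcons => -[xn].
  by exists (x, a).
Qed.

End cylinders.

(** * Scaling of unordered sums *)

Lemma esumZl (R : realType) (T : choiceType) (S : set T) (c : R)
    (f : T -> \bar R) : 0 <= c -> (forall x, 0 <= f x)%E ->
  (\esum_(x in S) (c%:E * f x) = c%:E * \esum_(x in S) f x)%E.
Proof.
rewrite le_eqVlt => /predU1P[<- f0|c0 f0].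
  by rewrite mul0e esum1// => x _; rewrite mul0e.
have le_esumZ k (g : T -> \bar R) : 0 < k -> (forall x, 0 <= g x)%E ->
    (\esum_(x in S) (k%:E * g x) <= k%:E * \esum_(x in S) g x)%E.
  move=> k0 g0; apply: ge_ereal_sup => _ [X XS <-].
  rewrite -ge0_mule_fsumr// lee_pmul2l//.
  by apply: ereal_sup_ubound; exists X.
apply/eqP; rewrite eq_le le_esumZ//= -lee_pdivlMl//.
(* The reverse inequality is the same one for the factor [c^-1] and the function [c * f]. *)
have := le_esumZ c^-1 (fun x => c%:E * f x)%E.
under eq_esum do rewrite muleA -EFinM mulVf ?gt_eqF// mul1e.
apply; first by rewrite invr_gt0.
by move=> x; rewrite mule_ge0 ?lee_fin ?(ltW c0).
Qed.

(** * The elementary inequality behind relative entropy *)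

Section relative_entropy.
Context {R : realType}.
Implicit Types u v x : R.

Lemma ln_le_subr1 x : 0 < x -> ln x <= x - 1.
Proof.
by move=> x0; rewrite -{1}(subrK 1 x) addrC le_ln1Dx// ltrBrDl addrN.
Qed.

(** For [u > 0] this is [ln (v / u) <= v / u - 1] multiplied by [u]. It serves three times: for the
    summands of [dKL], for the bound on the entropy and for the growth of the running maximum. *)
Lemma xlnx_div_ge0 u v : 0 <= u -> 0 <= v -> (0 < u -> 0 < v) ->
  0 <= u * ln (u / v) - u + v.
Proof.
rewrite le_eqVlt => /predU1P[<- v0 _|u0 v0 /(_ u0) {}v0].
  by rewrite mul0r subr0 add0r.
have := @ln_le_subr1 (v / u) (divr_gt0 v0 u0).
rewrite -(ler_pM2l u0) mulrBr mulr1 mulrCA divff ?gt_eqF// mulr1.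
rewrite -[u / v]invf_div lnV ?posrE ?divr_gt0//; lra.
Qed.

End relative_entropy.

(** * The Bayes mixture and its posterior *)

Section bayes.
Context (R : realType) (A : pointedType) (hA : countable [set: A]).
Context (K : nat) (nu : 'I_K -> probability (seqspace A) R) (m : 'I_K).
Implicit Types (x : seq A) (a : A) (i : 'I_K).

Let K_gt0 : (0 < K)%N. Proof. by case: K m => // -[]. Qed.
Let KR_gt0 : 0 < K%:R :> R. Proof. by rewrite ltr0n. Qed.
Let w0_gt0 : 0 < wprior R K. Proof. by rewrite invr_gt0. Qed.

Lemma cylm_rcons_le i x a : cylm (nu i) (rcons x a) <= cylm (nu i) x.
Proof.
rewrite -lee_fin !cylmE; apply: le_measure; rewrite ?inE;
  do ?exact: measurable_cyl.
by rewrite (cyl_rcons x) => om; exists a.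
Qed.

Lemma xi_ge0 x : 0 <= xi nu x.
Proof. by apply: sumr_ge0 => i _; rewrite mulr_ge0 ?(ltW w0_gt0) ?cylm_ge0. Qed.

(** Domination by the mixture: the source of absolute continuity, of posteriors at most [1] and of
    finite relative entropies. *)
Lemma le_cylm_xi i x : wprior R K * cylm (nu i) x <= xi nu x.
Proof.
rewrite /xi (bigD1 i)//= lerDl.
by apply: sumr_ge0 => j _; rewrite mulr_ge0 ?(ltW w0_gt0) ?cylm_ge0.
Qed.

Lemma xi_gt0 i x : 0 < cylm (nu i) x -> 0 < xi nu x.
Proof. by move=> h; apply: lt_le_trans (le_cylm_xi i x); rewrite mulr_gt0. Qed.

Lemma cylm_eq0 i x : xi nu x = 0 -> cylm (nu i) x = 0.
Proof.
move=> h; apply/eqP; rewrite eq_le cylm_ge0 andbT leNgt.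
by apply/negP => /xi_gt0; rewrite h ltxx.
Qed.

Lemma xi_rcons_le x a : xi nu (rcons x a) <= xi nu x.
Proof.
by apply: ler_sum => i _; rewrite ler_pM2l//; exact: cylm_rcons_le.
Qed.

Lemma xi_nil : xi nu [::] = 1.
Proof.
rewrite /xi; under eq_bigr do rewrite cylm_nil mulr1.
by rewrite sumr_const card_ord /wprior -[_^-1 *+ K]mulr_natr mulVf// gt_eqF.
Qed.

Lemma esum_xi_rcons x :
  (\esum_(a in [set: A]) (xi nu (rcons x a))%:E = (xi nu x)%:E)%E.
Proof.
under eq_esum do rewrite /xi -sumEFin.
rewrite esum_sum; last first.
  by move=> a i _ _; rewrite lee_fin mulr_ge0 ?(ltW w0_gt0) ?cylm_ge0.
rewrite /xi -sumEFin; apply: eq_bigr => i _.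
under eq_esum do rewrite EFinM.
rewrite esumZl ?(ltW w0_gt0)//; last by move=> a; rewrite lee_fin cylm_ge0.
by rewrite esum_cylm_rcons.
Qed.

Lemma wpost_ge0 i x : 0 <= wpost nu i x.
Proof.
by rewrite !(mulr_ge0, invr_ge0) ?xi_ge0 ?cylm_ge0// ltW.
Qed.

(** Bayes' rule cleared of its division, so that it also covers strings of mixture mass [0], where
    both sides vanish. *)
Lemma wpost_xi i x : xi nu x * wpost nu i x = wprior R K * cylm (nu i) x.
Proof.
have [x0|x0] := eqVneq (xi nu x) 0; first by rewrite x0 mul0r cylm_eq0 ?mulr0.
by rewrite /wpost mulrC divfK.
Qed.

Lemma wpost_le1 i x : wpost nu i x <= 1.
Proof.
have [x0|x0] := eqVneq (xi nu x) 0.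
  by rewrite /wpost cylm_eq0 ?mulr0 ?mul0r.
by rewrite /wpost ler_pdivrMr ?mul1r ?le_cylm_xi// lt_def x0 xi_ge0.
Qed.

Lemma sum_wpost x : 0 < xi nu x -> \sum_i wpost nu i x = 1.
Proof. by move=> x0; rewrite /wpost -mulr_suml divff ?gt_eqF. Qed.

Lemma wpost_nil i : wpost nu i [::] = K%:R^-1.
Proof. by rewrite /wpost xi_nil cylm_nil mulr1 divr1. Qed.

(** * Relative entropy as a sum of nonnegative terms *)

(* The added term [v - u] sums to [0] over the alphabet and makes every summand
   of the relative entropy nonnegative. *)
Definition gibbs i x a : R :=
  dterm nu i x a - condm (cylm (nu i)) x a + condm (xi nu) x a.

Lemma condm_ge0 (rho : seq A -> R) x a :
  (forall y, 0 <= rho y) -> 0 <= condm rho x a.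
Proof. by move=> h; rewrite divr_ge0. Qed.

Lemma condm_xi_gt0 i x a :
  0 < condm (cylm (nu i)) x a -> 0 < condm (xi nu) x a.
Proof.
move=> h; have n0 : 0 < cylm (nu i) (rcons x a).
  rewrite lt_neqAle cylm_ge0 andbT eq_sym.
  by apply: contraTneq h => h; rewrite /condm h mul0r ltxx.
by rewrite divr_gt0// (@xi_gt0 i)// (lt_le_trans n0)// cylm_rcons_le.
Qed.

Lemma gibbs_ge0 i x a : 0 <= gibbs i x a.
Proof.
apply: xlnx_div_ge0; [exact/condm_ge0/cylm_ge0|exact/condm_ge0/xi_ge0|].
exact: condm_xi_gt0.
Qed.

Lemma esum_condm (rho : seq A -> R) x : 0 < rho x -> (forall y, 0 <= rho y) ->
  (\esum_(a in [set: A]) (rho (rcons x a))%:E = (rho x)%:E)%E ->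
  (\esum_(a in [set: A]) (condm rho x a)%:E = 1)%E.
Proof.
move=> x0 r0 h; under eq_esum do rewrite /condm mulrC EFinM.
rewrite esumZl ?invr_ge0//; last by move=> a; rewrite lee_fin.
by rewrite h -EFinM mulVf// gt_eqF.
Qed.

(** By domination at [rcons x a], the likelihood ratio inside the logarithm is at most the inverse
    of the posterior weight at [x]. *)
Lemma dterm_le i x a : 0 < cylm (nu i) x ->
  dterm nu i x a <= - ln (wpost nu i x) * condm (cylm (nu i)) x a.
Proof.
move=> nx; have xx := xi_gt0 nx.
have u0 : 0 <= condm (cylm (nu i)) x a by exact/condm_ge0/cylm_ge0.
rewrite /dterm mulrC; move: u0; rewrite le_eqVlt => /predU1P[<-|u0].
  by rewrite !mulr0.
have v0 := condm_xi_gt0 u0.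
have w0 : 0 < wpost nu i x by rewrite !(mulr_gt0, invr_gt0).
have uv0 := divr_gt0 u0 v0.
rewrite ler_pM2r// -lnV ?posrE// ler_ln ?posrE// ?invr_gt0//.
rewrite ler_pdivrMr// ler_pdivlMl//.
have -> : wpost nu i x * condm (cylm (nu i)) x a =
    wprior R K * cylm (nu i) (rcons x a) / xi nu x.
  by rewrite /wpost /condm; field; rewrite !gt_eqF.
by rewrite ler_pM2r ?invr_gt0// le_cylm_xi.
Qed.

(** Let [u] and [v] be the conditional probabilities under [nu i] and [xi]. Each term is [F - G]
    with [F = gibbs + u] and [G = v] nonnegative and summable, so positive and negative parts
    recombine; the total masses [1] of [u] and [v] then cancel. *)
Lemma dKL_gibbs i x : 0 < cylm (nu i) x ->
  dKL nu i x = (\esum_(a in [set: A]) (gibbs i x a)%:E)%E.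
Proof.
move=> nx; have xx := xi_gt0 nx.
have su := esum_condm nx (@cylm_ge0 _ _ _) (esum_cylm_rcons hA (nu i) x).
have sv := esum_condm xx xi_ge0 (esum_xi_rcons x).
pose F a := ((gibbs i x a)%:E + (condm (cylm (nu i)) x a)%:E)%E.
pose G a := (condm (xi nu) x a)%:E.
have F0 a : (0 <= F a)%E.
  by rewrite adde_ge0// lee_fin ?gibbs_ge0//; exact/condm_ge0/cylm_ge0.
have G0 a : (0 <= G a)%E by rewrite lee_fin; exact/condm_ge0/xi_ge0.
have FG : (fun a => (dterm nu i x a)%:E) = (F \- G)%E.
  by apply/funext => a; rewrite /F /G -!EFinD /gibbs; congr EFin; ring.
have sG : summable setT G.
  by rewrite /summable; under eq_esum do rewrite gee0_abs//; rewrite sv ltry.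
(* [F] equals [dterm + v], and [dterm] is at most a constant times [u]. *)
have sF : summable setT F.
  rewrite /summable; under eq_esum do rewrite gee0_abs//.
  apply: (@le_lt_trans _ _ (\esum_(a in [set: A])
    ((- ln (wpost nu i x))%:E * (condm (cylm (nu i)) x a)%:E + G a))%E).
    apply: le_esum => a _; rewrite /F /G -EFinM -!EFinD lee_fin.
    by have := dterm_le a nx; rewrite /gibbs; lra.
  rewrite esumD//; last first.
    move=> a _; rewrite -EFinM lee_fin mulr_ge0 ?oppr_ge0 ?ln_le0 ?wpost_le1//.
    exact/condm_ge0/cylm_ge0.
  rewrite esumZl; last 2 first.
    by rewrite oppr_ge0 ln_le0 ?wpost_le1.
    by move=> a; rewrite lee_fin; exact/condm_ge0/cylm_ge0.
  by rewrite su sv mule1 -EFinD ltry.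
rewrite /dKL FG esumB// esumD; last 2 first.
- by move=> a _; rewrite lee_fin gibbs_ge0.
- by move=> a _; rewrite lee_fin; exact/condm_ge0/cylm_ge0.
by rewrite su sv addeK.
Qed.

(** The summand [ct] as a function of the string seen so far: [ct nu t om] is
    [gain (prefix om t.-1)]. *)
Definition gain x : \bar R := (\sum_(i < K) (wpost nu i x)%:E * dKL nu i x)%E.

Lemma gainE x : gain x =
  (\esum_(a in [set: A]) (\sum_i wpost nu i x * gibbs i x a)%:E)%E.
Proof.
under [RHS]eq_esum do rewrite -sumEFin.
rewrite esum_sum; last first.
  by move=> a i _ _; rewrite lee_fin mulr_ge0 ?wpost_ge0 ?gibbs_ge0.
apply: eq_bigr => i _; under [RHS]eq_esum do rewrite EFinM.
rewrite esumZl ?wpost_ge0//; last by move=> a; rewrite lee_fin gibbs_ge0.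
(* If [nu i] gives [x] mass [0], its posterior weight is [0] and both sides vanish. *)
have := cylm_ge0 (nu i) x; rewrite le_eqVlt => /predU1P[n0|n0].
  by rewrite /wpost -n0 mulr0 mul0r !mul0e.
by rewrite dKL_gibbs.
Qed.

Lemma gain_ge0 x : (0 <= gain x)%E.
Proof.
rewrite gainE; apply: esum_ge0 => a _; rewrite lee_fin.
by apply: sumr_ge0 => i _; rewrite mulr_ge0 ?wpost_ge0 ?gibbs_ge0.
Qed.

(** * Posterior entropy and its decrease *)

Definition entropy x : R := - \sum_i wpost nu i x * ln (wpost nu i x).

Lemma entropy_ge0 x : 0 <= entropy x.
Proof.
rewrite oppr_ge0; apply: sumr_le0 => i _.
by rewrite mulr_ge0_le0 ?wpost_ge0 ?ln_le0 ?wpost_le1.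
Qed.

(** The difference of the two sides is the relative entropy of the posterior to the uniform
    distribution. *)
Lemma entropy_le x : 0 < xi nu x -> entropy x <= ln K%:R.
Proof.
move=> x0; have -> : ln K%:R = \sum_i wpost nu i x * ln K%:R :> R.
  by rewrite -mulr_suml sum_wpost// mul1r.
rewrite /entropy -sumrN.
rewrite -subr_ge0 -sumrB.
apply: (@le_trans _ _ (\sum_i (wpost nu i x - K%:R^-1))).
  by rewrite sumrB sum_wpost// sumr_const card_ord -[_^-1 *+ K]mulr_natr
    mulVf ?subrr// gt_eqF.
apply: ler_sum => i _.
have := @xlnx_div_ge0 R (wpost nu i x) K%:R^-1 (wpost_ge0 i x).
rewrite invr_ge0 ler0n invr_gt0 => /(_ isT (fun _ => KR_gt0)).
have := wpost_ge0 i x; rewrite le_eqVlt => /predU1P[<-|w0].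
  by rewrite !mul0r; lra.
by rewrite invrK lnM ?posrE//; lra.
Qed.

(** By Bayes' rule the likelihood ratio of the symbol [a] is the ratio of new to old posterior
    weight. Hence the share of [a] in the gain is the relative entropy of the new posterior to the
    old one. *)
Lemma xi_gain x a : 0 < xi nu (rcons x a) ->
  xi nu x * \sum_i wpost nu i x * gibbs i x a =
  xi nu (rcons x a) * (- entropy (rcons x a) -
    \sum_i wpost nu i (rcons x a) * ln (wpost nu i x)).
Proof.
move=> X'0; have X0 : 0 < xi nu x by exact: lt_le_trans (xi_rcons_le x a).
set X' := xi nu (rcons x a); set X := xi nu x.
have step i : X * (wpost nu i x * gibbs i x a) =
    X' * (wpost nu i (rcons x a) * ln (wpost nu i (rcons x a))
          - wpost nu i (rcons x a) * ln (wpost nu i x)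
          - wpost nu i (rcons x a) + wpost nu i x).
  have wu : X * wpost nu i x * condm (cylm (nu i)) x a =
      X' * wpost nu i (rcons x a).
    rewrite !wpost_xi /condm.
    have [n0|n0] := eqVneq (cylm (nu i) x) 0; last first.
      by rewrite -mulrA (mulrCA _ _ (_^-1)) divff// mulr1.
    have := cylm_rcons_le i x a; rewrite n0 => h.
    have -> : cylm (nu i) (rcons x a) = 0.
      by apply/eqP; rewrite eq_le h cylm_ge0.
    by rewrite !(mulr0, mul0r).
  rewrite /gibbs /dterm; set u := condm _ x a; set v := condm (xi nu) x a.
  have Xv : X * v = X' by rewrite /v /condm mulrC divfK// gt_eqF.
  have -> : X * (wpost nu i x * (u * ln (u / v) - u + v)) =
     (X * wpost nu i x * u) * (ln (u / v) - 1) + (X * v) * wpost nu i x by ring.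
  rewrite wu Xv.
  (* The factor in front is kept because the logarithms agree only where the new posterior weight is
     positive. *)
  suff : wpost nu i (rcons x a) * ln (u / v) =
    wpost nu i (rcons x a) * (ln (wpost nu i (rcons x a)) - ln (wpost nu i x)).
    by move=> h; rewrite -mulrA mulrBr h; ring.
  have := wpost_ge0 i (rcons x a); rewrite le_eqVlt => /predU1P[<-|w'0].
    by rewrite !mul0r.
  have n'0 : 0 < cylm (nu i) (rcons x a).
    rewrite lt_neqAle cylm_ge0 andbT eq_sym.
    by apply: contraTneq w'0 => h; rewrite /wpost h mulr0 mul0r ltxx.
  have n0 := lt_le_trans n'0 (cylm_rcons_le i x a).
  rewrite -ln_div ?posrE//; last by rewrite !(mulr_gt0, invr_gt0).
  congr (_ * ln _); rewrite /u /v /condm /wpost -/X -/X'.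
  by field; rewrite !gt_eqF.
rewrite mulr_sumr (eq_bigr _ (fun i _ => step i)) -mulr_sumr; congr (_ * _).
(* The linear terms cancel, as the old and the new posterior both sum to [1]. *)
rewrite big_split /= !sumrB !sum_wpost// /entropy opprK; ring.
Qed.

(** * Running maximum, potential and its expected decrease *)

(** The running maximum over all prefixes, [[::]] and [x] included; the start value [0] is harmless
    since posteriors are nonnegative. *)
Definition pmax x : R :=
  foldl Num.max 0 [seq wpost nu m (take k x) | k <- iota 0 (size x).+1].

Lemma pmaxE x : pmax x =
  Num.max (foldl Num.max 0 [seq wpost nu m (take k x) | k <- iota 0 (size x)])
          (wpost nu m x).
Proof.
by rewrite /pmax -addn1 iotaD map_cat foldl_cat /= add0n take_size.
Qed.

Lemma pmax_nil : pmax [::] = K%:R^-1.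
Proof. by rewrite pmaxE /= wpost_nil maxEle invr_ge0 ler0n. Qed.

Lemma pmax_rcons x a :
  pmax (rcons x a) = Num.max (pmax x) (wpost nu m (rcons x a)).
Proof.
rewrite pmaxE size_rcons; congr (Num.max (foldl _ _ _) _).
apply/eq_in_map => k; rewrite mem_iota ltnS => /= kx.
by rewrite -cats1 takel_cat.
Qed.

Lemma wpost_le_pmax x : wpost nu m x <= pmax x.
Proof. by rewrite pmaxE le_max lexx orbT. Qed.

Lemma pmax_gt0 x : 0 < pmax x.
Proof.
elim/last_ind: x => [|x a ih]; first by rewrite pmax_nil invr_gt0.
by rewrite pmax_rcons lt_max ih.
Qed.

Lemma pmax_le1 x : pmax x <= 1.
Proof.
elim/last_ind: x => [|x a ih]; first by rewrite pmax_nil invf_le1// ler1n.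
by rewrite pmax_rcons ge_max ih wpost_le1.
Qed.

Definition potential x : R :=
  pmax x * entropy x - ln K%:R * wpost nu m x * ln (pmax x).

Lemma lnK_ge0 : 0 <= ln K%:R :> R.
Proof. by rewrite ln_ge0// ler1n. Qed.

Lemma potential_ge0 x : 0 <= potential x.
Proof.
rewrite addr_ge0 ?oppr_ge0//.
  by rewrite mulr_ge0 ?entropy_ge0 ?(ltW (pmax_gt0 x)).
by rewrite mulr_ge0_le0 ?ln_le0 ?pmax_le1// mulr_ge0 ?wpost_ge0 ?lnK_ge0.
Qed.

Lemma potential_nil : potential [::] = K%:R^-1 * (ln K%:R + ln K%:R ^+ 2).
Proof.
rewrite /potential /entropy pmax_nil.
under eq_bigr do rewrite !wpost_nil.
rewrite sumr_const card_ord wpost_nil lnV ?posrE// -[_ * _ *+ K]mulr_natr.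
by field; rewrite gt_eqF.
Qed.

(** Freezing the maximum at its old value [M] leaves coefficients that depend on [x] alone. If the
    new posterior [p] exceeds [M], the right side exceeds the left by [(p - M) * (L - H) + L * (p *
    ln (p / M) - p + M)]. *)
Lemma potential_rcons_le x a : 0 < xi nu (rcons x a) ->
  potential (rcons x a) <= pmax x * entropy (rcons x a)
    - ln K%:R * wpost nu m (rcons x a) * ln (pmax x).
Proof.
move=> X'0; rewrite /potential pmax_rcons.
have [//|lt_M] := leP (wpost nu m (rcons x a)) (pmax x).
set M := pmax x in lt_M *; set p := wpost _ _ _ in lt_M *.
set H := entropy _; set L := ln K%:R.
have M0 : 0 < M := pmax_gt0 x.
have p0 := lt_trans M0 lt_M.
have HL : (p - M) * H <= (p - M) * L by rewrite ler_pM2l ?subr_gt0// entropy_le.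
have : 0 <= L * (p * ln (p / M) - p + M).
  by rewrite mulr_ge0 ?lnK_ge0// xlnx_div_ge0// ltW.
by rewrite ln_div ?posrE//; lra.
Qed.

(** The entropy at [rcons x a] cancels between gain and potential. What remains is linear in the
    masses of [rcons x a], hence easy to sum over [a]. *)
Lemma potential_step_term x a :
  xi nu x * pmax x * (\sum_i wpost nu i x * gibbs i x a)
    + xi nu (rcons x a) * potential (rcons x a) <=
  \sum_i (pmax x * - ln (wpost nu i x)) * (wprior R K * cylm (nu i) (rcons x a))
    + (ln K%:R * - ln (pmax x)) * (wprior R K * cylm (nu m) (rcons x a)).
Proof.
have := xi_ge0 (rcons x a); rewrite le_eqVlt => /predU1P[/esym X'0|X'0].
  rewrite X'0 mul0r addr0 (cylm_eq0 m)// !mulr0 addr0 mulr_sumr.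
  apply: ler_sum => i _.
  by rewrite /gibbs /dterm /condm X'0 (cylm_eq0 i)//
    !(mulr0, mul0r, subr0, addr0).
rewrite mulrAC xi_gain//.
under [X in _ <= X + _]eq_bigr do rewrite -wpost_xi.
rewrite -wpost_xi.
have := potential_rcons_le X'0; rewrite -(ler_pM2l X'0).
rewrite [X in _ -> _ <= X + _](_ : _ = - (xi nu (rcons x a) * pmax x *
   \sum_i wpost nu i (rcons x a) * ln (wpost nu i x))); last first.
  by rewrite mulr_sumr -sumrN; apply: eq_bigr => i _; ring.
lra.
Qed.

Lemma potential_step x :
  ((xi nu x * pmax x)%:E * gain x +
    \esum_(a in [set: A]) (xi nu (rcons x a) * potential (rcons x a))%:E
   <= (xi nu x * potential x)%:E)%E.
Proof.
have M0 := ltW (pmax_gt0 x).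
have g0 a : 0 <= \sum_i wpost nu i x * gibbs i x a.
  by apply: sumr_ge0 => i _; rewrite mulr_ge0 ?wpost_ge0 ?gibbs_ge0.
have lnw0 i : 0 <= pmax x * - ln (wpost nu i x).
  by rewrite mulr_ge0// oppr_ge0 ln_le0// wpost_le1.
have lnM0 : 0 <= ln K%:R * - ln (pmax x).
  by rewrite mulr_ge0 ?lnK_ge0// oppr_ge0 ln_le0// pmax_le1.
have wn0 i y : 0 <= wprior R K * cylm (nu i) y.
  by rewrite mulr_ge0 ?cylm_ge0// ltW.
(* The martingale property of the posterior under [xi], in the division-free form of [wpost_xi]. *)
have esum_w i c : 0 <= c -> (\esum_(a in [set: A])
    (c * (wprior R K * cylm (nu i) (rcons x a)))%:E =
    (c * (wprior R K * cylm (nu i) x))%:E)%E.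
  move=> c0; under eq_esum do rewrite mulrA EFinM.
  rewrite esumZl ?esum_cylm_rcons ?mulrA//; first by rewrite mulr_ge0// ltW.
  by move=> a; rewrite lee_fin cylm_ge0.
rewrite gainE -esumZl ?mulr_ge0 ?xi_ge0//.
rewrite -esumD; last 2 first.
- by move=> a _; rewrite -EFinM lee_fin !mulr_ge0 ?xi_ge0.
- by move=> a _; rewrite lee_fin mulr_ge0 ?xi_ge0 ?potential_ge0.
apply: (@le_trans _ _ (\esum_(a in [set: A])
  (\sum_i ((pmax x * - ln (wpost nu i x)) *
           (wprior R K * cylm (nu i) (rcons x a)))%:E
    + ((ln K%:R * - ln (pmax x)) *
       (wprior R K * cylm (nu m) (rcons x a)))%:E))%E).
  apply: le_esum => a _; rewrite sumEFin -EFinM -!EFinD lee_fin.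
  exact: potential_step_term.
rewrite esumD; last 2 first.
- by move=> a _; apply: sume_ge0 => i _; rewrite lee_fin mulr_ge0.
- by move=> a _; rewrite lee_fin mulr_ge0.
rewrite esum_sum; last by move=> a i _ _; rewrite lee_fin mulr_ge0.
rewrite esum_w//; under eq_bigr do rewrite esum_w//.
rewrite sumEFin -EFinD lee_fin -wpost_xi.
under eq_bigr do rewrite -wpost_xi.
rewrite (_ : \sum_i _ = - (xi nu x * pmax x *
   \sum_i wpost nu i x * ln (wpost nu i x))); last first.
  by rewrite mulr_sumr -sumrN; apply: eq_bigr => i _; ring.
by rewrite /potential /entropy; lra.
Qed.

(** * Telescoping over time *)

Local Notation strings n := [set x : seq A | size x = n].

(** [K] times the [xi]-expectation of the potential after [n] symbols; the factor [K] stems from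
    [mu = K p xi]. *)
Definition total_potential n : \bar R :=
  (\esum_(x in strings n) (K%:R * (xi nu x * potential x))%:E)%E.

Lemma total_potential_step n :
  (\int[nu m]_om gain (Defs.prefix om n) + total_potential n.+1
   <= total_potential n)%E.
Proof.
have P0 x : 0 <= xi nu x * potential x.
  by rewrite mulr_ge0 ?xi_ge0 ?potential_ge0.
have KP0 x : (0 <= (K%:R * (xi nu x * potential x))%:E)%E.
  by rewrite lee_fin mulr_ge0 ?ler0n.
rewrite integral_prefix//; last exact: gain_ge0.
rewrite /total_potential esum_strings_rcons// -esumD; last 2 first.
- by move=> x _; rewrite mule_ge0 ?gain_ge0// lee_fin cylm_ge0.
- by move=> x _; exact: esum_ge0.
apply: le_esum => x _; under eq_esum do rewrite EFinM.
rewrite esumZl ?ler0n//; last by move=> a; rewrite lee_fin.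
rewrite [leRHS]EFinM.
apply: le_trans (lee_wpmul2l _ (potential_step x)); last first.
  by rewrite lee_fin ler0n.
rewrite ge0_muleDr; last 2 first.
- by rewrite mule_ge0 ?gain_ge0// lee_fin mulr_ge0 ?xi_ge0// ltW ?pmax_gt0.
- by apply: esum_ge0 => a _; rewrite lee_fin.
rewrite leeD2r// muleA -EFinM muleC lee_wpmul2r ?gain_ge0// lee_fin.
(* Change of measure from [mu] to [xi]; the density [K p] is then bounded through [p <= pmax x]. *)
have -> : cylm (nu m) x = K%:R * (xi nu x * wpost nu m x).
  by rewrite wpost_xi mulrA mulfV ?mul1r// gt_eqF.
by rewrite ler_pM2l// ler_wpM2l ?xi_ge0// wpost_le_pmax.
Qed.

Lemma total_potential0 : total_potential 0 = (ln K%:R + ln K%:R ^+ 2)%:E.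
Proof.
rewrite /total_potential (_ : strings 0 = [set [::]]); last first.
  by apply/seteqP; split=> [x /size0nil|x ->].
rewrite esum_set1; last first.
  by rewrite lee_fin !mulr_ge0 ?xi_ge0 ?potential_ge0 ?ler0n.
by rewrite xi_nil mul1r potential_nil mulrA mulfV ?mul1r// gt_eqF.
Qed.

Lemma sum_integral_gain_le n :
  (\sum_(0 <= k < n) \int[nu m]_om gain (Defs.prefix om k)
   <= (ln K%:R + ln K%:R ^+ 2)%:E)%E.
Proof.
have U0 k : (0 <= total_potential k)%E.
  apply: esum_ge0 => x _; rewrite lee_fin.
  by rewrite !mulr_ge0 ?xi_ge0 ?potential_ge0 ?ler0n.
(* The remaining potential is kept on the left so that the induction closes; being nonnegative, it
   is dropped at the end. *)
suff : (\sum_(0 <= k < n) \int[nu m]_om gain (Defs.prefix om k)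
  + total_potential n
   <= total_potential 0)%E.
  by rewrite total_potential0; apply: le_trans; rewrite leeDl.
elim: n => [|n ih]; first by rewrite big_nil add0e.
rewrite big_nat_recr//=; apply: le_trans ih.
by rewrite -addeA leeD2l// total_potential_step.
Qed.

Lemma integral_Cinf_le :
  (\int[nu m]_om Cinf nu om <= (ln K%:R + ln K%:R ^+ 2)%:E)%E.
Proof.
have CE om : Cinf nu om = (\sum_(k <oo) gain (Defs.prefix om k))%E.
  (* Time [t] starts at [1] and sees a prefix of length [t.-1]; the shift indexes by that length. *)
  rewrite /Cinf -(@nneseries_addn _ (fun t => ct nu t om) 1); last first.
    by move=> t; exact: gain_ge0.
  by apply: eq_eseriesr => t _; rewrite addn1.
under eq_integral do rewrite CE.
rewrite integral_nneseries//; last 2 first.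
- by move=> n; exact: measurable_prefix.
- by move=> n om _; exact: gain_ge0.
apply: lime_le.
  apply: is_cvg_nneseries => n _ _.
  by apply: integral_ge0 => om _; exact: gain_ge0.
by apply: nearW => n; exact: sum_integral_gain_le.
Qed.

End bayes.

Theorem theorem5 (R : realType) (A : pointedType) (hA : countable [set: A])
  (K : nat) (nu : 'I_K -> probability (seqspace A) R)
  (nu_inj : forall i j : 'I_K,
     (nu i : set (seqspace A) -> \bar R) = nu j -> i = j)
  (m : 'I_K) :
  (\int[nu m]_om Cinf nu om <=
     ((6 * ln (K%:R : R) ^+ 2 + 14 * ln (K%:R : R) + 8)%:E))%E.
Proof.
apply: le_trans (integral_Cinf_le hA nu m) _; rewrite lee_fin.
have := lnK_ge0 R m; set L := ln _ => L0.
have : 0 <= L ^+ 2 by exact: exprn_ge0.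
(* The slack is [5 * L ^+ 2 + 13 * L + 8]. *)
lra.
Qed.
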